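(* Let $k,t\ge1$ and $\lambda=(k^t)=(k,k,\dots,k)$ ($t$ parts), with length $\ell(\lambda)=t$. Then for $n\ge0$, \[ \mathrm{ehr}(\mathcal{O}(P_\lambda),n)=s_\lambda(1^{n+\ell(\lambda)})=\prod_{u\in\lambda}\frac{n+\ell(\lambda)+c(u)}{h(u)}, \] where for a cell $u=(i,j)$ of $\lambda$, $h(u)=\lambda_i+\lambda'_j-i-j+1$ is its hook length and $c(u)=j-i$ its content.
   Context: For a partition $\lambda=(\lambda_1\ge\cdots\ge\lambda_t>0)$, the Ferrers poset $P_\lambda$ has as elements the cells $(i,j)$, $1\le j\le\lambda_i$, ordered by $(i,j)\preceq(i',j')$ iff $i'\le i$ and $j'\le j$. For a finite poset $P$, the order polytope $\mathcal{O}(P)\subset\mathbb{R}^P$ is defined by $0\le x_s\le1$ and $x_s\le x_{s'}$ whenever $s\prec s'$; $\mathrm{ehr}(\mathcal{O}(P),n)=|n\mathcal{O}(P)\cap\mathbb{Z}^P|$ for $n\ge1$, $=1$ for $n=0$. $\lambda'$ is the conjugate partition. $s_\lambda(1^N)$ is the Schur function $s_\lambda$ evaluated at $x_1=\cdots=x_N=1$ and all other variables $0$, i.e. the number of semistandard Young tableaux of shape $\lambda$ (rows weakly increasing, columns strictly increasing) with entries in $\{1,\dots,N\}$. *)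

(* Defs.v *)
From HB Require Import structures.
From mathcomp Require Import all_boot all_order all_algebra.
From mathcomp Require Import finmap.
From mathcomp Require Import boolp classical_sets functions cardinality reals.

Set Implicit Arguments.
Unset Strict Implicit.
Unset Printing Implicit Defensive.

Import Order.TTheory GRing.Theory Num.Theory.

Local Open Scope classical_set_scope.
Local Open Scope ring_scope.

(* A partition is the sequence of its parts, in weakly decreasing order.
   Rows, columns and part indices are numbered from 1. *)
Definition part (la : seq nat) (i : nat) : nat := nth 0%N la i.-1.

Definition conjugate (la : seq nat) : seq nat :=
  mkseq (fun j => count (leq j.+1) la) (part la 1).

Definition ferrers (la : seq nat) : Type :=
  {i : 'I_(size la) & 'I_(part la i.+1)}.

HB.instance Definition _ (la : seq nat) :=
  Finite.copy (ferrers la) {i : 'I_(size la) & 'I_(part la i.+1)}.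

Definition cell_row (la : seq nat) (u : ferrers la) : nat := (tag u).+1.
Definition cell_col (la : seq nat) (u : ferrers la) : nat := (tagged u).+1.

Lemma cell_row_col_inj (la : seq nat) (u v : ferrers la) :
  cell_row u = cell_row v -> cell_col u = cell_col v -> u = v.
Proof.
rewrite /cell_row /cell_col; case: u v => [i j] [i' j'] /= [eqi] [eqj].
move/val_inj: eqi => eqi; subst i'.
by move/val_inj: eqj => ->.
Qed.

Definition ferrers_le (la : seq nat) : rel (ferrers la) :=
  fun u v => (cell_row v <= cell_row u)%N && (cell_col v <= cell_col u)%N.

Lemma ferrers_le_refl (la : seq nat) : reflexive (@ferrers_le la).
Proof. by move=> u; rewrite /ferrers_le !leqnn. Qed.

Lemma ferrers_le_anti (la : seq nat) : antisymmetric (@ferrers_le la).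
Proof.
move=> u v /andP[/andP[r1 c1] /andP[r2 c2]].
by apply: cell_row_col_inj; apply/eqP; rewrite eqn_leq ?r1 ?r2 ?c1 ?c2.
Qed.

Lemma ferrers_le_trans (la : seq nat) : transitive (@ferrers_le la).
Proof.
move=> v u w /andP[r1 c1] /andP[r2 c2].
by rewrite /ferrers_le (leq_trans r2 r1) (leq_trans c2 c1).
Qed.

Fact ferrers_display : Order.disp_t. Proof. exact: Order.Disp tt tt. Qed.

HB.instance Definition _ (la : seq nat) :=
  Order.Le_isPOrder.Build ferrers_display (ferrers la)
    (@ferrers_le_refl la) (@ferrers_le_anti la) (@ferrers_le_trans la).

Definition order_polytope (R : realType) (d : Order.disp_t)
    (P : finPOrderType d) : set {ffun P -> R} :=
  [set x | (forall s, 0 <= x s <= 1) /\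
           (forall s s' : P, (s < s')%O -> x s <= x s')].
Arguments order_polytope : clear implicits.
Arguments order_polytope R {d} P.

Definition dilate (R : realType) (I : finType) (n : nat)
    (A : set {ffun I -> R}) : set {ffun I -> R} :=
  [set [ffun s => n%:R * x s] | x in A].

Definition lattice_points (R : realType) (I : finType) : set {ffun I -> R} :=
  [set x | forall s, x s \is a Num.int].
Arguments lattice_points : clear implicits.

(* [fset_set] of an infinite set is empty, so [ehr] is the number of lattice
   points of the dilate whenever this number is finite. *)
Definition ehr (R : realType) (I : finType) (A : set {ffun I -> R})
    (n : nat) : nat :=
  if n == 0%N then 1%N
  else #|` fset_set (dilate n A `&` lattice_points R I)|%fset.

(* The entries 1, ..., N of a tableau are encoded as 'I_N. *)
Definition semistandard (la : seq nat) (N : nat)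
    (T : {ffun ferrers la -> 'I_N}) : bool :=
  [forall u, forall v,
     ((cell_row u == cell_row v) && (cell_col u < cell_col v)%N
      ==> (T u <= T v)%N) &&
     ((cell_col u == cell_col v) && (cell_row u < cell_row v)%N
      ==> (T u < T v)%N)].

(* s_la(x_1, ..., x_N, 0, 0, ...) *)
Definition schur (A : comNzSemiRingType) (la : seq nat) (N : nat)
    (x : 'I_N -> A) : A :=
  \sum_(T : {ffun ferrers la -> 'I_N} | semistandard T)
    \prod_(u : ferrers la) x (T u).

Definition content (la : seq nat) (u : ferrers la) : int :=
  (cell_col u)%:Z - (cell_row u)%:Z.

Definition hook (la : seq nat) (u : ferrers la) : int :=
  (part la (cell_row u))%:Z + (part (conjugate la) (cell_col u))%:Z
  - (cell_row u)%:Z - (cell_col u)%:Z + 1.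

(* Main.v *)
Require Import Defs.
From HB Require Import structures.
From mathcomp Require Import all_boot all_order all_algebra.
From mathcomp Require Import finmap.
From mathcomp Require Import boolp classical_sets functions cardinality reals.
From mathcomp Require Import perm zify.

(* Lattice points of n O(P) for a t x k rectangle are plane partitions in a
   t x k x n box, and so are semistandard tableaux with entries in [1, n + t]
   once the row index is subtracted.  Placed diagonal by diagonal, such an array
   is the free part of a Gelfand-Tsetlin pattern over the row (0^k, n^t).  With
   l_i = la_i + i, the number of patterns over la is det (C(l_i, j)): summing
   this determinant over the rows that interlace la gives the same determinant
   one size larger.  It equals the Vandermonde quotient
   prod_(i < j) (l_j - l_i) / (j - i), in which only the pairs i < k <= j
   contribute, and these give the hook-content product. *)

Set Implicit Arguments.
Unset Strict Implicit.
Unset Printing Implicit Defensive.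

Import Order.TTheory GRing.Theory Num.Theory.
Local Open Scope ring_scope.

(** * Binomial determinants *)

(** Hockey-stick identity: by Pascal's rule the sum telescopes. *)
Lemma sum_bin_col (i j a b : nat) : (a <= b)%N ->
  (\sum_(a <= v < b) 'C(v + i, j) = 'C(b + i, j.+1) - 'C(a + i, j.+1))%N.
Proof.
move=> /subnK <-; elim: (b - a)%N => [|d IHd]; first by rewrite add0n big_geq ?subnn.
rewrite addSn big_nat_recr ?leq_addl //= IHd [in RHS]addSn binS.
by rewrite addnBAC ?leq_bin2l ?leq_add2r ?leq_addl.
Qed.

Definition bin_mx (N : nat) (l : nat -> nat) : 'M[int]_N :=
  \matrix_(i, j) ('C(l i, j))%:Z.

(* Subtract from each row the previous one: column 0, which is constant 1,
   becomes the first basis vector. *)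
Lemma det_bin_mx_diff (N : nat) (l : nat -> nat) :
  \det (bin_mx N.+1 l) =
  \det (\matrix_(i < N, j < N) ('C(l i.+1, j.+1)%:Z - 'C(l i, j.+1)%:Z)).
Proof.
pose L : 'M[int]_N.+1 := \matrix_(i, j) ((i == j)%:Z - (i == j.+1 :> nat)%:Z).
have detL : \det L = 1.
  rewrite det_trig; last first.
    apply/is_trig_mxP => i j lt_ij; rewrite !mxE -val_eqE /= (ltn_eqF lt_ij).
    by rewrite (ltn_eqF (leqW lt_ij)) subrr.
  by rewrite big1 // => i _; rewrite mxE eqxx ltn_eqF ?subr0.
have LA i j : (L *m bin_mx N.+1 l) i j =
    'C(l i, j)%:Z - (if (i : nat) is i'.+1 then 'C(l i', j)%:Z else 0).
  rewrite mxE (eq_bigr (fun p => (i == p)%:Z * 'C(l p, j)%:Z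
      - (i == p.+1 :> nat)%:Z * 'C(l p, j)%:Z)); last by move=> p _; rewrite !mxE mulrBl.
  rewrite sumrB (bigD1 i) //= eqxx mul1r big1 ?addr0; last first.
    by move=> p /negPf; rewrite eq_sym => ->; rewrite mul0r.
  congr (_ - _); case: i => [[|i] lt_iN] /=; first by rewrite big1 // => p _; rewrite mul0r.
  rewrite (bigD1 (Ordinal (ltnW lt_iN))) //= eqxx mul1r big1 ?addr0 // => p.
  by rewrite eqSS -val_eqE /= eq_sym => /negPf ->; rewrite mul0r.
rewrite -[LHS]mul1r -detL -det_mulmx (expand_det_col _ ord0) big_ord_recl.
rewrite [X in _ + X]big1 ?addr0 => [|i _]; last by rewrite LA /= !bin0 subrr mul0r.
rewrite LA /= bin0 subr0 mul1r /cofactor /= addn0 expr0 mul1r; congr (\det _).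
by apply/matrixP => i j; rewrite mxE mxE LA !mxE /= /bump /= !add1n.
Qed.

(* By multilinearity in the rows, the sum over mu acts entrywise, where it is a
   hockey-stick sum. *)
Lemma sum_interlacing_det (M N : nat) (la : nat -> nat) :
  (forall i, (i < N)%N -> (la i <= la i.+1)%N) ->
  (forall i, (i <= N)%N -> (la i < M)%N) ->
  \sum_(mu : {ffun 'I_N -> 'I_M} | [forall i : 'I_N, la i <= mu i <= la i.+1]%N)
     \det (\matrix_(i < N, j < N) ('C(mu i + i, j))%:Z)
  = \det (bin_mx N.+1 (fun i => la i + i)%N).
Proof.
move=> la_mono la_lt; rewrite det_bin_mx_diff.
rewrite exchange_big /=; apply: eq_bigr => s _; rewrite -big_distrr /=; congr (_ * _).
rewrite (eq_bigr (fun mu : {ffun 'I_N -> 'I_M} => \prod_i ('C(mu i + i, s i))%:Z)); last first.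
  by move=> mu _; apply: eq_bigr => i _; rewrite !mxE.
rewrite (eq_bigl (fun mu => mu \in
    family (fun i : 'I_N => [pred v : 'I_M | la i <= v <= la i.+1]%N))); last first.
  by move=> mu; apply/forallP/familyP.
rewrite -(bigA_distr_big_dep _ (fun (i : 'I_N) (v : 'I_M) => ('C(v + i, s i))%:Z)) /=.
apply: eq_bigr => i _; rewrite mxE.
have leS : (la i <= (la i.+1).+1)%N by rewrite leqW // la_mono.
(* The closed upper bound [la i.+1] makes the telescoping sum end at [(la i.+1).+1 + i], which is
   the next shifted part [la i.+1 + i.+1]: this is why part [i] is shifted by [i]. *)
have -> : ('C(la i.+1 + i.+1, (s i).+1)%:Z - 'C(la i + i, (s i).+1)%:Z)
   = (\sum_(la i <= v < (la i.+1).+1) 'C(v + i, s i))%N%:Z.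
  rewrite sum_bin_col // addSnnS subzn // leq_bin2l // leq_add ?leqnSn //.
  exact: la_mono.
rewrite -natz natr_sum (big_nat_widenl _ 0) // (big_nat_widen _ _ M) ?la_lt // big_mkord.
by apply: eq_big => [v|v _]; rewrite ?natz //= ltnS.
Qed.

(** Falling factorials are monic polynomials of degree [j], so the matrix is a Vandermonde matrix
    times a unitriangular matrix of coefficients. *)
Lemma det_ffact_mx (N : nat) (l : nat -> nat) :
  \det (\matrix_(i < N, j < N) ((l i) ^_ j)%:R : 'M[rat]_N)
  = \prod_(i < N) \prod_(j < N | (i < j)%N) ((l j)%:R - (l i)%:R).
Proof.
pose p (j : nat) : {poly rat} := \prod_(0 <= r < j) ('X - (r%:R)%:P).
have p_val j a : (p j).[a%:R] = (a ^_ j)%:R.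
  rewrite horner_prod; elim: j => [|j IHj]; first by rewrite big_geq.
  rewrite big_nat_recr //= IHj ffactnSr natrM !hornerE.
  (* [ffactnSr] brings in the truncated [a - j]; for [a < j] both sides vanish with [a ^_ j]. *)
  have [le_ja|lt_aj] := leqP j a; first by rewrite natrB.
  by rewrite ffact_small // !mul0r.
have size_p j : size (p j) = j.+1 by rewrite size_prod_XsubC size_iota subn0.
have monic_p j : p j \is monic by exact: monic_prod_XsubC.
pose Cf : 'M[rat]_N := \matrix_(r, j) (p j)`_r.
have detCf : \det Cf = 1.
  rewrite -det_tr det_trig; last first.
    by apply/is_trig_mxP => i j lt_ij; rewrite !mxE nth_default // size_p.
  rewrite big1 // => i _; rewrite !mxE.
  by have /monicP := monic_p i; rewrite lead_coefE size_p.
have := det_Vandermonde (\row_(j < N) ((l j)%:R : rat)).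
move=> /(congr1 (fun x => x * \det Cf)); rewrite detCf !mulr1 -[in LHS]detCf => VE.
transitivity (\det ((Vandermonde N (\row_(j < N) ((l j)%:R : rat)))^T *m Cf)).
  congr (\det _); apply/matrixP => i j; rewrite !mxE -p_val.
  rewrite (horner_coef_wide (n := N)) ?size_p //.
  by apply: eq_bigr => r _; rewrite !mxE mulrC.
rewrite det_mulmx det_tr detCf mulr1 det_Vandermonde.
by apply: eq_bigr => i _; apply: eq_bigr => j _; rewrite !mxE.
Qed.

(** Scaling column [j] by [j!] turns binomials into falling factorials. The total factor is read off
    from [l = id], where the binomial matrix is unitriangular. *)
Lemma det_bin_mxE (N : nat) (l : nat -> nat) :
  (\det (bin_mx N l))%:~R = \prod_(i < N) \prod_(j < N | (i < j)%N)
     (((l j)%:R - (l i)%:R) / (j%:R - i%:R)) :> rat.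
Proof.
have fact_det (m : nat -> nat) :
    \prod_(j < N) (j`!)%:R * (\det (bin_mx N m))%:~R =
    \prod_(i < N) \prod_(j < N | (i < j)%N) ((m j)%:R - (m i)%:R) :> rat.
  rewrite -det_ffact_mx -det_map_mx.
  have -> : \prod_(j < N) (j`!)%:R = \det (diag_mx (\row_(j < N) (j`!)%:R)) :> rat.
    by rewrite det_diag; apply: eq_bigr => j _; rewrite mxE.
  rewrite mulrC -det_mulmx; congr (\det _); apply/matrixP => i j.
  by rewrite mul_mx_diag !mxE -bin_ffact natrM.
have det_id : \det (bin_mx N id) = 1.
  rewrite det_trig; first by rewrite big1 // => i _; rewrite mxE binn.
  by apply/is_trig_mxP => i j lt_ij; rewrite mxE bin_small.
have := fact_det id; rewrite det_id mulr1 => factE.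
have fact_neq0 : \prod_(j < N) (j`!)%:R != 0 :> rat.
  by apply/prodf_neq0 => j _; rewrite pnatr_eq0 -lt0n fact_gt0.
apply: (mulfI fact_neq0); rewrite fact_det factE -big_split.
apply: eq_bigr => i _; rewrite -big_split; apply: eq_bigr => j lt_ij /=.
by rewrite mulrCA divff ?mulr1 // subr_eq0 eqr_nat gtn_eqF.
Qed.

(** Two indices on the same side of [k] have equal parts, so their factor is 1. *)
Lemma det_bin_mx_box (k t n : nat) :
  (\det (bin_mx (k + t) (fun i => (if i < k then 0 else n) + i)%N))%:~R =
  \prod_(i < k) \prod_(j < t) (((n + k + j)%:R - i%:R) / ((k + j)%:R - i%:R)) :> rat.
Proof.
rewrite det_bin_mxE big_split_ord /=.
rewrite [X in _ * X]big1 ?mulr1; last first.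
  move=> i _; rewrite big1 // => j lt_ij; have le_kj := leq_trans (leq_addr _ _) (ltnW lt_ij).
  rewrite !ltnNge leq_addr le_kj /= !(natrD _ n) opprD addrACA subrr add0r divff //.
  by rewrite subr_eq0 eqr_nat gtn_eqF.
apply: eq_bigr => i _; rewrite big_split_ord /= big1 ?mul1r; last first.
  move=> j lt_ij; rewrite !ltn_ord !add0n divff //.
  by rewrite subr_eq0 eqr_nat gtn_eqF.
rewrite (eq_bigl xpredT) => [|j]; last by rewrite ltn_addr.
by apply: eq_bigr => j _; rewrite ltn_ord ltnNge leq_addr /= add0n addnA.
Qed.

(** * Gelfand-Tsetlin patterns *)

(** Lets a finite row serve as the parameter [la] of the next smaller triangle; interlacing never
    inspects the 0 past its end. *)
Definition ext_row (M N : nat) (mu : {ffun 'I_N -> 'I_M}) (i : nat) : nat :=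
  if insub i is Some i' then mu i' : nat else 0%N.

Lemma ext_rowE (M N : nat) (mu : {ffun 'I_N -> 'I_M}) (i : 'I_N) :
  ext_row mu i = mu i.
Proof. by rewrite /ext_row valK. Qed.

(* The rows of sizes 0, ..., N-1 of a Gelfand-Tsetlin triangle, each weakly
   increasing, longest first; the row la of size N on which the triangle
   stands is kept outside, as a parameter. *)
Fixpoint gt_pattern (M N : nat) : finType :=
  if N is N'.+1 then ({ffun 'I_N' -> 'I_M} * gt_pattern M N')%type else unit.

Fixpoint is_gt (M N : nat) : (nat -> nat) -> gt_pattern M N -> bool :=
  if N is N'.+1 return (nat -> nat) -> gt_pattern M N -> bool then
    fun la p => [forall i : 'I_N', la i <= p.1 i <= la i.+1]%N
                && is_gt (ext_row p.1) p.2
  else fun _ _ => true.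

Lemma card_gt_pattern (M N : nat) (la : nat -> nat) :
  (forall i, (i.+1 < N)%N -> (la i <= la i.+1)%N) ->
  (forall i, (i < N)%N -> (la i < M)%N) ->
  #|[pred p : gt_pattern M N | is_gt la p]|%:Z = \det (bin_mx N (fun i => la i + i)%N).
Proof.
elim: N la => [|N IHN] la la_mono la_lt.
  by rewrite det_mx00 (eq_card (B := predT)) ?card_unit.
rewrite -(sum_interlacing_det (M := M)) //.
rewrite -sum1_card -[LHS]natz natr_sum.
rewrite (eq_bigl (fun p : {ffun 'I_N -> 'I_M} * gt_pattern M N =>
  [forall i : 'I_N, la i <= p.1 i <= la i.+1]%N && is_gt (ext_row p.1) p.2)) //.
rewrite -(pair_big_dep (fun mu : {ffun 'I_N -> 'I_M} => [forall i : 'I_N, la i <= mu i <= la i.+1]%N)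
  (fun mu q => is_gt (ext_row mu) q) (fun _ _ => 1%:R)) /=.
apply: eq_bigr => mu /forallP mu_la.
rewrite -natr_sum sum1_card natz IHN.
- by congr (\det _); apply/matrixP => i j; rewrite !mxE ext_rowE.
(* The induction hypothesis asks for an increasing row: [mu i <= la i.+1 <= mu i.+1]. *)
- move=> i lt_iN; have lt_iN' := ltnW lt_iN.
  rewrite -[i]/(val (Ordinal lt_iN')) -[i.+1]/(val (Ordinal lt_iN)) !ext_rowE.
  case/andP: (mu_la (Ordinal lt_iN')) => _ /leq_trans-> //.
  by case/andP: (mu_la (Ordinal lt_iN)).
- by move=> i lt_iN; rewrite -[i]/(val (Ordinal lt_iN)) ext_rowE.
Qed.

(* Row m has entries i = 0, ..., m-1; the value is junk when i >= m. *)
Fixpoint gt_entry (M N : nat) : (nat -> nat) -> gt_pattern M N -> nat -> nat -> nat :=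
  if N is N'.+1 return (nat -> nat) -> gt_pattern M N -> nat -> nat -> nat then
    fun la p m i => if m == N'.+1 then la i else gt_entry (ext_row p.1) p.2 m i
  else fun la _ _ i => la i.

Lemma gt_entry_top (M N : nat) (la : nat -> nat) (p : gt_pattern M N) i :
  gt_entry la p N i = la i.
Proof. by case: N p => //= N p; rewrite eqxx. Qed.

(** Trades the recursion for inequalities between neighbouring entries, the form in which patterns
    are compared with arrays. *)
Lemma is_gtP (M N : nat) (la : nat -> nat) (p : gt_pattern M N) :
  reflect (forall m i, (i < m < N)%N ->
     (gt_entry la p m.+1 i <= gt_entry la p m i <= gt_entry la p m.+1 i.+1)%N)
   (is_gt la p).
Proof.
elim: N la p => [|N IHN] la p /=; first by constructor=> m i; rewrite ltn0 andbF.
apply: (iffP andP) => [[/forallP top /IHN below] m i /andP[lt_im]|valid].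
  rewrite ltnS leq_eqVlt eqSS => /predU1P[eq_mN|lt_mN].
    move: lt_im; rewrite eq_mN eqxx ltn_eqF // gt_entry_top => lt_iN.
    by have := top (Ordinal lt_iN); rewrite -ext_rowE.
  by rewrite !ltn_eqF ?ltnS ?(ltnW lt_mN) //; apply: below; rewrite lt_im.
split.
  apply/forallP => i; have := valid N i; rewrite ltn_ord ltnS leqnn eqxx ltn_eqF //.
  by rewrite gt_entry_top ext_rowE; apply.
apply/IHN => m i /andP[lt_im lt_mN].
have := valid m i; rewrite lt_im ltnS (ltnW lt_mN) eqSS !ltn_eqF ?ltnS ?(ltnW lt_mN) //.
by apply.
Qed.

Fixpoint gt_of (M N : nat) (g : nat -> nat -> nat) : gt_pattern M.+1 N :=
  if N is N'.+1 return gt_pattern M.+1 N then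
    ([ffun i : 'I_N' => inord (g N' i) : 'I_M.+1], gt_of M N' g)
  else tt.

(** The top row is not stored, so [g] has to agree with [la] there; the bound by [M] keeps [inord]
    from losing values. *)
Lemma gt_ofK (M N : nat) (la : nat -> nat) (g : nat -> nat -> nat) :
  (forall i, (i < N)%N -> g N i = la i) ->
  (forall m i, (i < m < N)%N -> (g m i <= M)%N) ->
  forall m i, (i < m <= N)%N -> gt_entry la (gt_of M N g) m i = g m i.
Proof.
elim: N la => [|N IHN] la g_top g_le m i /andP[lt_im]; first by case: m lt_im.
rewrite leq_eqVlt /= => /predU1P[eq_mN|lt_mN].
  by rewrite eq_mN eqxx g_top // -eq_mN.
rewrite ltn_eqF // IHN // ?lt_im // => [i' lt_i'N|m' i' /andP[lt_i' lt_m']].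
  rewrite -[i']/(val (Ordinal lt_i'N)) ext_rowE ffunE inordK //= ltnS.
  by apply: g_le; rewrite lt_i'N leqnn.
by apply: g_le; rewrite lt_i' ltnW.
Qed.

Lemma gt_entryK (M N : nat) (la : nat -> nat) (p : gt_pattern M.+1 N)
    (g : nat -> nat -> nat) :
  (forall m i, (i < m < N)%N -> g m i = gt_entry la p m i) -> gt_of M N g = p.
Proof.
elim: N la p => [|N IHN] la p /= gE; first by case: p {gE}.
case: p gE => mu q /= gE; congr (_, _); last first.
  apply: (IHN (ext_row mu)) => m i /andP[lt_im lt_mN].
  by rewrite gE ?lt_im ?ltnS ?(ltnW lt_mN) // ltn_eqF ?ltnS // ltnW.
apply/ffunP => i; rewrite ffunE; apply/val_inj => /=.
by rewrite gE ?ltn_ord ?ltnS ?leqnn // ltn_eqF // gt_entry_top ext_rowE inord_val.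
Qed.

(** * Plane partitions in a box as Gelfand-Tsetlin patterns *)

Definition is_box_pp (t k n : nat) (x : {ffun 'I_t * 'I_k -> 'I_n}) : bool :=
  [forall p : 'I_t * 'I_k, forall q : 'I_t * 'I_k, (p.1 <= q.1)%N && (p.2 <= q.2)%N ==> (x q <= x p)%N].

Lemma is_box_ppP (t k n : nat) (x : {ffun 'I_t * 'I_k -> 'I_n}) :
  reflect (forall (a : 'I_t) (b : 'I_k) (a' : 'I_t) (b' : 'I_k), (a <= a')%N -> (b <= b')%N -> (x (a', b') <= x (a, b))%N)
    (is_box_pp x).
Proof.
apply: (iffP forallP) => [mono a b a' b' le_a le_b|mono [a b]].
  by have /forallP/(_ (a', b')) := mono (a, b); rewrite /= le_a le_b.
by apply/forallP => -[a' b']; apply/implyP => /andP[]; apply: mono.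
Qed.

Section GTMono.
Variables (M N : nat) (la : nat -> nat) (p : gt_pattern M N).
Hypothesis p_gt : is_gt la p.

(** Chains the left interlacing inequality, as [gt_entry_diag] chains the right one. In the
    parallelogram these two directions change the row and the column of the array, respectively. *)
Lemma gt_entry_col (i m m' : nat) : (i < m <= m')%N -> (m' <= N)%N ->
  (gt_entry la p m' i <= gt_entry la p m i)%N.
Proof.
move=> /andP[lt_im /subnK <-]; elim: (m' - m)%N => // d IHd le_N.
apply: leq_trans (IHd (ltnW le_N)).
by have /is_gtP/(_ (d + m)%N i) := p_gt; rewrite addSn; case/(_ _)/andP => //; lia.
Qed.

Lemma gt_entry_diag (i m d : nat) : (i < m)%N -> (m + d <= N)%N ->
  (gt_entry la p m i <= gt_entry la p (m + d) (i + d))%N.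
Proof.
move=> lt_im; elim: d => [|d IHd]; first by rewrite !addn0.
rewrite !addnS => le_N; apply: leq_trans (IHd (ltnW le_N)) _.
by have /is_gtP/(_ (m + d)%N (i + d)%N) := p_gt; case/(_ _)/andP => //; lia.
Qed.
End GTMono.

Arguments is_gt : simpl never.
Arguments gt_entry : simpl never.
Arguments gt_of : simpl never.

Section BoxPP.
Variables (t k n : nat).
Let N := (k.+1 + t.+1)%N.
Let la (i : nat) := if (i < k.+1)%N then 0%N else n.

(* An array sits in the parallelogram i <= k, m - i - 1 <= t of the triangle over
   (0^(k+1), n^(t+1)); interlacing forces n to its right and 0 to its left. *)
Definition pad (x : {ffun 'I_t.+1 * 'I_k.+1 -> 'I_n.+1}) (m i : nat) : nat :=
  if (k < i)%N then n else
  if (t < m - i.+1)%N then 0%N else x (inord (m - i.+1), inord (k - i)).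

(** The position [(m, i)] of cell [(a, b)] solves [k - i = b] and [m - i - 1 = a]. *)
Definition unpad (p : gt_pattern n.+1 N) : {ffun 'I_t.+1 * 'I_k.+1 -> 'I_n.+1} :=
  [ffun ab : 'I_t.+1 * 'I_k.+1 => inord (gt_entry la p (k - ab.2 + ab.1).+1 (k - ab.2))].

Lemma pad_le x m i : (pad x m i <= n)%N.
Proof. by rewrite /pad; do 2?case: ifP => // _; rewrite -ltnS. Qed.

Lemma pad_top x i : (i < N)%N -> pad x N i = la i.
Proof.
rewrite /N /pad /la ltnS => lt_iN; have [//|le_ik] := ltnP k i.
by have -> : (t < k.+1 + t.+1 - i.+1)%N by lia.
Qed.

Lemma entry_pad x m i : (i < m <= N)%N ->
  gt_entry la (gt_of n N (pad x)) m i = pad x m i.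
Proof. by apply: gt_ofK => [|m' i' _]; [exact: pad_top | exact: pad_le]. Qed.

Lemma is_gt_pad x : is_box_pp x -> is_gt la (gt_of n N (pad x)).
Proof.
move=> /is_box_ppP x_pp; apply/is_gtP => m i /andP[lt_im lt_mN].
rewrite !entry_pad; try lia.
apply/andP; split.
  (* With [i] fixed, passing to [m.+1] moves one array row further: it can leave the array for the
     zeros but not come back. *)
  rewrite {2}/pad; case: ltnP => [_|le_ik]; first exact: pad_le.
  rewrite /pad ltnNge le_ik /=.
  have [//|le_mi] := ltnP t (m.+1 - i.+1).
  have -> : (t < m - i.+1)%N = false by lia.
  by apply: x_pp => //; rewrite !inordK; lia.
(* Both positions have the same [m - i - 1], hence lie on the same side of the bound [t]. *)
rewrite {2}/pad subSS; case: ltnP => [_|lt_ik]; first exact: pad_le.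
rewrite /pad.
have -> : (k < i)%N = false by lia.
by case: ifP => // le_mi; apply: x_pp => //; rewrite !inordK; lia.
Qed.

Lemma padK x : unpad (gt_of n N (pad x)) = x.
Proof.
apply/ffunP => -[a b]; rewrite ffunE /=; apply/val_inj => /=.
have ? := ltn_ord a; have ? := ltn_ord b.
rewrite entry_pad; last by lia.
rewrite inordK ?ltnS ?pad_le // /pad.
have -> : (k < k - b)%N = false by lia.
have -> : (t < (k - b + a).+1 - (k - b).+1)%N = false by lia.
have -> : ((k - b + a).+1 - (k - b).+1 = a)%N by lia.
have -> : (k - (k - b) = b)%N by lia.
by rewrite !inord_val.
Qed.

Lemma la_le i : (la i <= n)%N. Proof. by rewrite /la; case: ifP. Qed.

(** The diagonal through an entry increases up to the top row. *)
Lemma entry_le (p : gt_pattern n.+1 N) m i : is_gt la p -> (i < m <= N)%N ->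
  (gt_entry la p m i <= n)%N.
Proof.
move=> p_gt /andP[lt_im le_mN].
have := gt_entry_diag p_gt lt_im (d := N - m); rewrite subnKC // leqnn gt_entry_top.
by move=> /(_ isT)/leq_trans; apply; apply: la_le.
Qed.

Lemma is_box_pp_unpad p : is_gt la p -> is_box_pp (unpad p).
Proof.
move=> p_gt; apply/is_box_ppP => a b a' b' le_a le_b; rewrite !ffunE /=.
have ? := ltn_ord a'; have ? := ltn_ord b'.
rewrite !inordK ?ltnS; try by apply: entry_le => //; lia.
(* The intermediate entry is that of cell [(a, b')]. *)
apply: (@leq_trans (gt_entry la p (k - b' + a).+1 (k - b'))).
  by apply: gt_entry_col => //; rewrite /N; lia.
have := @gt_entry_diag _ _ la p p_gt (k - b') (k - b' + a).+1 (b' - b).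
have -> : ((k - b' + a).+1 + (b' - b) = (k - b + a).+1)%N by lia.
have -> : (k - b' + (b' - b) = k - b)%N by lia.
by apply; rewrite /N; lia.
Qed.

Lemma unpadK p : is_gt la p -> gt_of n N (pad (unpad p)) = p.
Proof.
move=> p_gt; apply: (gt_entryK (la := la)) => m i /andP[lt_im lt_mN].
have le_n : (gt_entry la p m i <= n)%N by apply: entry_le => //; lia.
rewrite /pad; case: ltnP => [lt_ki|le_ik].
  apply/eqP; rewrite eqn_leq le_n andbT.
  (* Right of the parallelogram, the entry is at least the [n] found in the top row at the same
     [i]. *)
  have la_n : la i = n by rewrite /la ltnS leqNgt lt_ki.
  have le_imN : (i < m <= N)%N by lia.
  by have := gt_entry_col p_gt le_imN (leqnn N); rewrite gt_entry_top la_n.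
case: ltnP => [lt_t|le_t].
  (* Left of it, the diagonal ends in the top row at index [i + (N - m) <= k], where [la] is 0. *)
  have := @gt_entry_diag _ _ la p p_gt i m (N - m) lt_im; rewrite subnKC ?(ltnW lt_mN) //.
  have la_0 : la (i + (N - m)) = 0%N by rewrite /la ifT // /N; lia.
  by rewrite leqnn gt_entry_top la_0 leqn0 => /(_ isT)/eqP.
rewrite ffunE /=.
rewrite [(inord (k - i) : nat)]inordK ?ltnS ?leq_subr // [(inord (m - _) : nat)]inordK ?ltnS //.
have -> : (k - (k - i) = i)%N by lia.
have -> : ((i + (m - i.+1)).+1 = m)%N by lia.
by rewrite inordK.
Qed.

Lemma card_box_pp :
  #|[pred x : {ffun 'I_t.+1 * 'I_k.+1 -> 'I_n.+1} | is_box_pp x]|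
  = #|[pred p : gt_pattern n.+1 N | is_gt la p]|.
Proof.
rewrite -!sum1_card [RHS](reindex_onto (fun x => gt_of n N (pad x)) unpad) /=; last first.
  by move=> p; apply: unpadK.
apply: eq_bigl => x; rewrite !inE padK eqxx andbT.
by apply/idP/idP => [/is_gt_pad|/is_box_pp_unpad] //; rewrite padK.
Qed.

Lemma card_box_pp_prod :
  #|[pred x : {ffun 'I_t.+1 * 'I_k.+1 -> 'I_n.+1} | is_box_pp x]|%:R =
  \prod_(i < k.+1) \prod_(j < t.+1)
     (((n + k.+1 + j)%:R - i%:R) / ((k.+1 + j)%:R - i%:R)) :> rat.
Proof.
rewrite -det_bin_mx_box -(card_gt_pattern (M := n.+1)) ?card_box_pp //.
  by move=> i _; case: (ltnP i.+1) => [/ltnW -> //|_]; exact: la_le.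
by move=> i _; exact: la_le.
Qed.
End BoxPP.

(** * Rectangular tableaux and order polytopes *)

Section RectangularCells.
Variables (t k : nat).
Let la := nseq t k.

Fact rect_row_proof (a : 'I_t) : (a < size la)%N.
Proof. by rewrite size_nseq. Qed.

Fact rect_col_proof (a : 'I_t) (b : 'I_k) : (b < part la (Ordinal (rect_row_proof a)).+1)%N.
Proof. by rewrite /part /la nth_nseq /= !ltn_ord. Qed.

Definition rect_cell (p : 'I_t * 'I_k) : ferrers la :=
  Tagged (fun i : 'I_(size la) => 'I_(part la i.+1)) (Ordinal (rect_col_proof p.1 p.2)).

Fact cell_row_proof (u : ferrers la) : (tag u < t)%N.
Proof. by rewrite -[t in X in (_ < X)%N](size_nseq t k). Qed.

Fact cell_col_proof (u : ferrers la) : (tagged u < k)%N.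
Proof. by have := ltn_ord (tagged u); rewrite [X in (_ < X)%N -> _]nth_nseq cell_row_proof. Qed.

Definition cell_pos (u : ferrers la) : 'I_t * 'I_k :=
  (Ordinal (cell_row_proof u), Ordinal (cell_col_proof u)).

Lemma rect_cellK : cancel rect_cell cell_pos.
Proof. by case=> a b; congr (_, _); apply/val_inj. Qed.

Lemma cell_posK : cancel cell_pos rect_cell.
Proof. by move=> u; apply: cell_row_col_inj. Qed.

(** The poset order reverses both coordinates, so order-preserving labellings decrease weakly along
    rows and columns, as plane partitions do. *)
Lemma rect_cell_le a b a' b' :
  (rect_cell (a, b) <= rect_cell (a', b'))%O = (a' <= a)%N && (b' <= b)%N.
Proof. by []. Qed.

Lemma semistandardP N (T : {ffun ferrers la -> 'I_N}) :
  reflect ((forall (a : 'I_t) (b b' : 'I_k), (b < b')%N ->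
              (T (rect_cell (a, b)) <= T (rect_cell (a, b')))%N) /\
           (forall (a a' : 'I_t) (b : 'I_k), (a < a')%N ->
              (T (rect_cell (a, b)) < T (rect_cell (a', b)))%N))
          (semistandard T).
Proof.
apply: (iffP forallP) => [Tss|[Trow Tcol] u].
  split=> [a b b' lt_b|a a' b lt_a].
    have /forallP/(_ (rect_cell (a, b'))) := Tss (rect_cell (a, b)).
    by rewrite /cell_row /cell_col /= eqxx !ltnS lt_b => /andP[].
  have /forallP/(_ (rect_cell (a', b))) := Tss (rect_cell (a, b)).
  by rewrite /cell_row /cell_col /= eqxx !ltnS lt_a => /andP[].
apply/forallP => v; rewrite -[u]cell_posK -[v]cell_posK.
case: (cell_pos u) (cell_pos v) => [a b] [a' b']; rewrite /cell_row /cell_col /= !eqSS !ltnS.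
apply/andP; split; apply/implyP => /andP[/eqP/val_inj eq_ab].
  by rewrite eq_ab; apply: Trow.
by rewrite eq_ab; apply: Tcol.
Qed.

Lemma hook_rect_cell (p : 'I_t * 'I_k) :
  hook (rect_cell p) = k%:Z + t%:Z - p.1%:Z - p.2%:Z - 1.
Proof.
case: p => a b; rewrite /hook /cell_row /cell_col /=.
have -> : part la a.+1 = k by rewrite /part /la nth_nseq ltn_ord.
have -> : part (conjugate la) b.+1 = t.
  have part1 : part la 1 = k by rewrite /part /la nth_nseq (leq_trans _ (ltn_ord a)).
  by rewrite {1}/part nth_mkseq ?part1 //= /la count_nseq /= ltn_ord mul1n.
by rewrite /=; lia.
Qed.

Lemma content_rect_cell (p : 'I_t * 'I_k) : content (rect_cell p) = p.2%:Z - p.1%:Z.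
Proof. by rewrite /content /cell_row /cell_col /=; lia. Qed.

End RectangularCells.

(** * Semistandard tableaux as plane partitions *)

Section Tableaux.
Variables (t k n : nat).
Let la := nseq t.+1 k.+1.

(* Subtracting the (0-based) row index makes a tableau weakly increasing in both
   directions with values in [0, n]; its complement to n is a plane partition. *)
Definition ssyt_of_pp (x : {ffun 'I_t.+1 * 'I_k.+1 -> 'I_n.+1}) :
    {ffun ferrers la -> 'I_(n + t).+1} :=
  [ffun u => inord (n - x (cell_pos u) + (cell_pos u).1)].

Definition pp_of_ssyt (T : {ffun ferrers la -> 'I_(n + t).+1}) :
    {ffun 'I_t.+1 * 'I_k.+1 -> 'I_n.+1} :=
  [ffun p => inord (n - (T (rect_cell p) - p.1))].

Lemma ssyt_of_ppE x p :
  ssyt_of_pp x (rect_cell p) = (n - x p + p.1)%N :> nat.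
Proof.
by rewrite ffunE rect_cellK inordK // ltnS leq_add ?leq_subr // -ltnS.
Qed.

Lemma ssyt_of_ppK : cancel ssyt_of_pp pp_of_ssyt.
Proof.
move=> x; apply/ffunP => p; rewrite ffunE; apply/val_inj.
by rewrite ssyt_of_ppE addnK subKn -1?ltnS // inord_val.
Qed.

Lemma semistandard_ssyt_of_pp x : is_box_pp x -> semistandard (ssyt_of_pp x).
Proof.
move=> /is_box_ppP x_pp; apply/semistandardP; split=> [a b b' lt_b|a a' b lt_a].
  by rewrite !ssyt_of_ppE leq_add2r leq_sub2l // x_pp // ltnW.
by rewrite !ssyt_of_ppE -addnS leq_add // leq_sub2l // x_pp // ltnW.
Qed.

(** Strictness gains at least 1 at each step down a column. *)
Lemma ssyt_col (T : {ffun ferrers la -> 'I_(n + t).+1}) (a a' : 'I_t.+1) (b : 'I_k.+1) : semistandard T -> (a <= a')%N ->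
  (T (rect_cell (a, b)) + (a' - a) <= T (rect_cell (a', b)))%N.
Proof.
move=> /semistandardP[_ Tcol] /subnK; move: (a' - a)%N => d.
elim: d a' => [|d IHd] a' eq_a'.
  by rewrite addn0; have <- : a = a' by apply/val_inj.
have lt_a'' : (d + a < t.+1)%N by have := ltn_ord a'; lia.
rewrite addnS; apply: leq_ltn_trans (IHd (Ordinal lt_a'') _) (Tcol _ _ _ _) => //=.
by rewrite -eq_a'.
Qed.

(** Comparison with the two ends of the column: at least 0 in row 0, at most [n + t] in row [t].
    Hence the truncated subtractions in [pp_of_ssyt] are exact on tableaux. *)
Lemma ssyt_bounds (T : {ffun ferrers la -> 'I_(n + t).+1}) (a : 'I_t.+1) (b : 'I_k.+1) : semistandard T ->
  (a <= T (rect_cell (a, b)) <= n + a)%N.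
Proof.
move=> Tss; apply/andP; split.
  by have := ssyt_col b Tss (leq0n a : (@ord0 t <= a)%N); rewrite subn0 /=; lia.
have := ssyt_col b Tss (leq_ord a : (a <= @ord_max t)%N).
have := ltn_ord (T (rect_cell (@ord_max t, b))); have := ltn_ord a => /=; lia.
Qed.

Lemma pp_of_ssytE T a b : pp_of_ssyt T (a, b) = (n - (T (rect_cell (a, b)) - a))%N :> nat.
Proof. by rewrite ffunE inordK // ltnS leq_subr. Qed.

Lemma pp_of_ssytK T : semistandard T -> ssyt_of_pp (pp_of_ssyt T) = T.
Proof.
move=> Tss; apply/ffunP => u; rewrite -[u]cell_posK; case: (cell_pos u) => a b.
apply/val_inj; rewrite /= ssyt_of_ppE pp_of_ssytE /=.
by have := ssyt_bounds a b Tss; lia.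
Qed.

Lemma is_box_pp_of_ssyt T : semistandard T -> is_box_pp (pp_of_ssyt T).
Proof.
move=> Tss; apply/is_box_ppP => a b a' b' le_a le_b; rewrite !pp_of_ssytE leq_sub2l //.
have le_T : (T (rect_cell (a', b)) <= T (rect_cell (a', b')))%N.
  move: le_b; rewrite leq_eqVlt => /predU1P[/val_inj -> //|lt_b].
  by have /semistandardP[Trow _] := Tss; apply: Trow.
(* From [T (a, b) + (a' - a) <= T (a', b')], taking [a'] off both sides leaves [T (a, b) - a] on the
   left. *)
have := leq_sub2r a' (leq_trans (ssyt_col b Tss le_a) le_T).
by rewrite addnBA // subnAC addnK.
Qed.

Lemma schur_rect :
  schur la (fun _ : 'I_(n + t).+1 => 1%N)
  = #|[pred x : {ffun 'I_t.+1 * 'I_k.+1 -> 'I_n.+1} | is_box_pp x]|.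
Proof.
rewrite /schur (eq_bigr (fun=> 1%N)) => [|T _]; last by rewrite big1.
rewrite -sum1_card (reindex_onto ssyt_of_pp pp_of_ssyt) /=; last exact: pp_of_ssytK.
apply: eq_bigl => x; rewrite !inE ssyt_of_ppK eqxx andbT.
by apply/idP/idP => [/is_box_pp_of_ssyt|/semistandard_ssyt_of_pp //]; rewrite ssyt_of_ppK.
Qed.

End Tableaux.

(** * Lattice points of the dilated order polytope *)

Section Ehrhart.
Variables (R : realType) (t k n : nat).
Let la := nseq t k.

Definition lattice_point_of (x : {ffun 'I_t * 'I_k -> 'I_n.+1}) : {ffun ferrers la -> R} :=
  [ffun u => (x (cell_pos u))%:R].

Lemma lattice_point_of_inj : injective lattice_point_of.
Proof.
move=> x y /ffunP eq_xy; apply/ffunP => p; apply/val_inj/eqP.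
by have := eq_xy (rect_cell p); rewrite !ffunE rect_cellK => /eqP; rewrite eqr_nat.
Qed.

Local Open Scope classical_set_scope.

(** Integral coordinates in [[0, n]] are naturals, so truncation loses nothing; conversely an array
    is divided by [n > 0]. The right-hand side also shows finiteness, without which [fset_set] would
    be empty. *)
Lemma lattice_points_dilate : (0 < n)%N ->
  dilate n (order_polytope R (ferrers la)) `&` lattice_points R (ferrers la)
  = [set` [fset lattice_point_of x | x in [pred x | is_box_pp x]]%fset].
Proof.
move=> n_gt0; have n_gt0R : 0 < n%:R :> R by rewrite ltr0n.
apply/seteqP; split=> y /=.
  move=> [[z [z01 z_mono] <-] y_int]; set w := [ffun _ => _].
  have wE u : w u = n%:R * z u by rewrite ffunE.
  have w_nat u : w u \is a Num.nat.
    by rewrite natrEint y_int wE mulr_ge0 //; case/andP: (z01 u).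
  clearbody w; have w_le u : (Num.truncn (w u) <= n)%N.
    rewrite -(ler_nat R) truncnK // wE ler_piMr //.
    by case/andP: (z01 u).
  apply/imfsetP; exists [ffun p => inord (Num.truncn (w (rect_cell p)))] => /=.
    apply/is_box_ppP => a b a' b' le_a le_b.
    rewrite !ffunE !inordK ?ltnS // -(ler_nat R) !truncnK // !wE ler_wpM2l //.
    have : (rect_cell (a', b') <= rect_cell (a, b))%O by rewrite rect_cell_le le_a.
    by rewrite le_eqVlt => /predU1P[-> //|]; apply: z_mono.
  by apply/ffunP => u; rewrite [RHS]ffunE ffunE cell_posK inordK ?ltnS // truncnK.
move=> /imfsetP[x /= /is_box_ppP x_pp ->{y}]; split; last first.
  by move=> u; rewrite ffunE natr_int.
exists [ffun u => (x (cell_pos u))%:R / n%:R]; last first.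
  by apply/ffunP => u; rewrite !ffunE mulrC divfK // gt_eqF.
split=> [u|u v /ltW].
  by rewrite ffunE divr_ge0 //= ler_pdivrMr // mul1r ler_nat -ltnS.
rewrite -{1}[u]cell_posK -{1}[v]cell_posK !ffunE ler_pM2r ?invr_gt0 // ler_nat.
case: (cell_pos u) (cell_pos v) => [a b] [a' b']; rewrite rect_cell_le => /andP[].
exact: x_pp.
Qed.

Lemma ehr_rect : ehr (order_polytope R (ferrers la)) n
  = #|[pred x : {ffun 'I_t * 'I_k -> 'I_n.+1} | is_box_pp x]|.
Proof.
rewrite /ehr; case: posnP => [->|n_gt0].
  (* For [n = 0] the conventional value 1 counts the zero array, the only one with values in
     ['I_1]. *)
  rewrite (eq_card (B := predT)) ?card_ffun ?card_ord ?exp1n // => x; rewrite !inE.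
  by apply/is_box_ppP => a b a' b' _ _; rewrite !ord1.
by rewrite lattice_points_dilate // set_fsetK card_imfset ?cardE //; exact: lattice_point_of_inj.
Qed.

End Ehrhart.

(* Numerators match under reversal of both indices, denominators under
   reversal of the row index alone. *)
Lemma box_prodE (t k n : nat) :
  \prod_(i < k.+1) \prod_(j < t.+1)
     (((n + k.+1 + j)%:R - i%:R) / ((k.+1 + j)%:R - i%:R)) =
  \prod_(u : ferrers (nseq t.+1 k.+1))
     (((n + t).+1%:Z + content u)%:~R / (hook u)%:~R) :> rat.
Proof.
have rev_bij m : {on predT, bijective (@rev_ord m)}.
  by apply: onW_bij; exists (@rev_ord m); apply: rev_ordK.
rewrite (reindex (@rect_cell t.+1 k.+1)); last first.
  by apply: onW_bij; exists (@cell_pos t.+1 k.+1); [exact: rect_cellK | exact: cell_posK].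
under [RHS]eq_bigr do rewrite content_rect_cell hook_rect_cell.
rewrite -(pair_bigA _ (fun (a : 'I_t.+1) (b : 'I_k.+1) =>
  (((n + t).+1%:Z + (b%:Z - a%:Z))%:~R /
   (k.+1%:Z + t.+1%:Z - a%:Z - b%:Z - 1)%:~R))) /=.
rewrite [LHS]exchange_big /= [LHS](reindex _ (rev_bij _)) /=.
under eq_bigr do rewrite big_split; under [RHS]eq_bigr do rewrite big_split.
rewrite !big_split /=; congr (_ * _).
  apply: eq_bigr => a _; rewrite [LHS](reindex _ (rev_bij _)) /=; apply: eq_bigr => b _.
  have [lt_a lt_b] := (ltn_ord a, ltn_ord b); rewrite !subSS !pmulrn -!rmorphB /=.
  suff -> : (n + k.+1 + (t - a))%N%:Z - (k - b)%N%:Z = (n + t).+1%:Z + (b%:Z - a%:Z) by [].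
  by lia.
apply: eq_bigr => a _; apply: eq_bigr => b _.
have [lt_a lt_b] := (ltn_ord a, ltn_ord b); rewrite !subSS !pmulrn -!rmorphB /=.
suff -> : (k.+1 + (t - a))%N%:Z - b%:Z = k.+1%:Z + t.+1%:Z - a%:Z - b%:Z - 1 by [].
by lia.
Qed.

Theorem theorem5p11 (R : realType) (k t n : nat)
    (hk : (1 <= k)%N) (ht : (1 <= t)%N) :
  let la := nseq t k in
  ehr (order_polytope R (ferrers la)) n
    = schur la (fun _ : 'I_(n + size la) => 1%N) /\
  (schur la (fun _ : 'I_(n + size la) => 1%N))%:R
    = \prod_(u : ferrers la)
        (((n + size la)%:Z + content u)%:~R / (hook u)%:~R) :> rat.
Proof.
(* Positive sides become successors, the form that [inord] requires in the bijections above. *)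
case: k t hk ht => [|k] [|t] // _ _ la.
have : (n + size la = (n + t).+1)%N by rewrite size_nseq addnS.
(* The bound occurs in the type ['I_(n + size la)], so it is generalized before being rewritten. *)
move: (n + size la)%N => N ->.
by rewrite schur_rect ehr_rect card_box_pp_prod box_prodE.
Qed.
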